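(* For any totally bounded metric space $X$ and real number $a>0$, the total homology $\mathrm{H}(\mathrm{Rips}(X,a^{-}))$ has a countable basis.
   Context: $\mathrm{H}=\bigoplus_{k\ge0}\mathrm{H}_k$ is simplicial homology with coefficients in a fixed field $\mathbf{k}$, and basis means basis as a $\mathbf{k}$-vector space; countable includes finite. For a metric space $(X,d_X)$ and $a\in\mathbf{R}$, the open Vietoris--Rips complex $\mathrm{Rips}(X,a^-)$ is the simplicial complex whose simplices are the nonempty finite subsets $\{x_0,\dots,x_k\}\subseteq X$ with $d_X(x_i,x_j)<a$ for all $i,j$. A metric space is totally bounded if for every $\varepsilon>0$ it has a finite subset $F$ such that every point is at distance $<\varepsilon$ from some point of $F$. *)

(* Defs.v *)
From HB Require Import structures.
From mathcomp Require Import all_boot all_order all_algebra finmap.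
From mathcomp Require Import generic_quotient ring_quotient freeg.
From mathcomp Require Import all_classical all_reals.
From mathcomp Require Import wochoice topology.

Set Implicit Arguments.
Unset Strict Implicit.
Unset Printing Implicit Defensive.

Import Order.TTheory GRing.Theory Num.Theory.

Local Open Scope classical_set_scope.
Local Open Scope quotient_scope.
Local Open Scope fset_scope.
Local Open Scope ring_scope.

Section Basis.
Variables (F : fieldType) (V : lmodType F).

Definition lin_indep (B : set V) : Prop :=
  forall (s : seq V) (c : V -> F), uniq s -> {in s, forall v, B v} ->
    \sum_(v <- s) c v *: v = 0 -> {in s, forall v, c v = 0}.

Definition spanning (B : set V) : Prop :=
  forall v : V, exists (s : seq V) (c : V -> F),
    {in s, forall w, B w} /\ v = \sum_(w <- s) c w *: w.

Definition is_basis (B : set V) : Prop := lin_indep B /\ spanning B.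

Definition has_countable_basis : Prop :=
  exists B : set V, countable B /\ is_basis B.

End Basis.

Section QuotientModule.
Variables (F : fieldType) (V : lmodType F) (W : {pred V}).
Hypothesis submodW : submod_closed W.

(* Carrying the proof as an argument lets W be given its canonical structure. *)
Definition submod_pred (_ : submod_closed W) : {pred V} := W.

HB.instance Definition _ := GRing.isSubmodClosed.Build F V
  (submod_pred submodW) submodW.

Definition quotient_module : Type := Quotient.quot (submod_pred submodW).

HB.instance Definition _ := GRing.Zmodule.on quotient_module.
HB.instance Definition _ := ZmodQuotient.on quotient_module.

Definition quotient_scale (a : F) (q : quotient_module) : quotient_module :=
  \pi_quotient_module (a *: repr q).

Lemma pi_scale (a : F) (v : V) :
  quotient_scale a (\pi_quotient_module v) = \pi_quotient_module (a *: v).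
Proof.
apply/eqP; rewrite -Quotient.idealrBE -scalerBr; apply: rpredZ.
by rewrite Quotient.idealrBE reprK.
Qed.

Lemma quotient_scaleA a b q :
  quotient_scale a (quotient_scale b q) = quotient_scale (a * b) q.
Proof. by elim/quotW: q => v;
  rewrite (pi_scale b v) (pi_scale a) (pi_scale _ v) scalerA. Qed.

Lemma quotient_scale1 : left_id 1 quotient_scale.
Proof. by elim/quotW=> v; rewrite (pi_scale 1 v) scale1r. Qed.

Lemma pi_add (u v : V) : \pi_quotient_module u + \pi_quotient_module v =
  \pi_quotient_module (u + v).
Proof. by rewrite -pi_addr. Qed.

Lemma quotient_scaleDr : right_distributive quotient_scale +%R.
Proof.
move=> a; elim/quotW=> u; elim/quotW=> v.
by rewrite pi_add (pi_scale a u) (pi_scale a v) (pi_scale a) pi_add scalerDr.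
Qed.

Lemma quotient_scaleDl q : {morph quotient_scale^~ q : a b / a + b}.
Proof.
elim/quotW: q => v a b.
by rewrite (pi_scale a v) (pi_scale b v) (pi_scale _ v) pi_add scalerDl.
Qed.

HB.instance Definition _ := GRing.Zmodule_isLmodule.Build F quotient_module
  quotient_scaleA quotient_scale1 quotient_scaleDr quotient_scaleDl.

End QuotientModule.

Section DirectSum.
Variables (F : fieldType) (M : nat -> lmodType F).

Definition dprod : Type := forall k, M k.

HB.instance Definition _ := gen_eqMixin dprod.
HB.instance Definition _ := gen_choiceMixin dprod.

Let add (f g : dprod) : dprod := fun k => f k + g k.
Let opp (f : dprod) : dprod := fun k => - f k.
Let scale (a : F) (f : dprod) : dprod := fun k => a *: f k.

Let addA : associative add.
Proof. by move=> f g h; apply: functional_extensionality_dep => k;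
  exact: addrA. Qed.
Let addC : commutative add.
Proof. by move=> f g; apply: functional_extensionality_dep => k;
  exact: addrC. Qed.
Let add0 : left_id (fun k => 0) add.
Proof. by move=> f; apply: functional_extensionality_dep => k;
  exact: add0r. Qed.
Let addN : left_inverse (fun k => 0) opp add.
Proof. by move=> f; apply: functional_extensionality_dep => k;
  exact: addNr. Qed.

HB.instance Definition _ := GRing.isZmodule.Build dprod addA addC add0 addN.

Let scaleA a b f : scale a (scale b f) = scale (a * b) f.
Proof. by apply: functional_extensionality_dep => k;
  exact: scalerA. Qed.
Let scale1 : left_id 1 scale.
Proof. by move=> f; apply: functional_extensionality_dep => k;
  exact: scale1r. Qed.
Let scaleDr : right_distributive scale +%R.
Proof. by move=> a f g; apply: functional_extensionality_dep => k;
  exact: scalerDr. Qed.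
Let scaleDl f : {morph scale^~ f : a b / a + b}.
Proof. by move=> a b; apply: functional_extensionality_dep => k;
  exact: scalerDl. Qed.

HB.instance Definition _ :=
  GRing.Zmodule_isLmodule.Build F dprod scaleA scale1 scaleDr scaleDl.

Definition finitely_supported : {pred dprod} :=
  fun f => `[< exists n : nat, forall k, (n <= k)%N -> f k = 0 >].

Lemma finitely_supported_submod : submod_closed finitely_supported.
Proof.
split=> [|a f g /asboolP[m fm] /asboolP[n gn]]; apply/asboolP.
  by exists 0%N.
exists (maxn m n) => k; rewrite geq_max => /andP[mk nk].
have -> : (a *: f + g) k = a *: f k + g k by [].
by rewrite fm// gn// scaler0 addr0.
Qed.

HB.instance Definition _ := GRing.isSubmodClosed.Build F dprod
  finitely_supported finitely_supported_submod.

Definition direct_sum : Type := {f : dprod | f \in finitely_supported}.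

HB.instance Definition _ := SubChoice.on direct_sum.
HB.instance Definition _ := [SubChoice_isSubLmodule of direct_sum by <:].

End DirectSum.

Record simplicial_complex (T : choiceType) := SimplicialComplex {
  simplex : set {fset T};
  simplex_neq0 : forall s, simplex s -> s != fset0;
  simplex_face : forall s t, simplex s -> t `<=` s -> t != fset0 -> simplex t
}.

(* A total order on the vertices, used to orient the simplices. It is obtained
   from the well-ordering principle; up to isomorphism the homology does not
   depend on it. *)
Definition vertex_le (T : choiceType) : rel T :=
  sval (well_ordering_principle T).

Section Homology.
Variables (F : fieldType) (T : choiceType).

Local Notation chain := {freeg {fset T} / F}.

(* The index of v in the increasing enumeration of s. *)
Definition vertex_index (s : {fset T}) (v : T) : nat :=
  #|` [fset w in s | (w != v) && vertex_le w v] |.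

(* d[v_0, ..., v_k] = \sum_i (-1)^i [v_0, ..., v_(i-1), v_(i+1), ..., v_k] for
   v_0 < ... < v_k. The boundary of a vertex is 0, as the empty set is not a
   simplex: the homology is unreduced. *)
Definition simplex_boundary (s : {fset T}) : chain :=
  if (#|` s| <= 1)%N then 0
  else \sum_(v <- s) (-1) ^+ vertex_index s v *: << s `\ v >>.

Definition boundary (c : chain) : chain := fglift simplex_boundary c.

Lemma boundaryB : {morph boundary : c d / c - d}.
Proof. exact: lift_is_additive. Qed.

Lemma boundary0 : boundary 0 = 0.
Proof. by rewrite -[X in boundary X](subrr 0) boundaryB subrr. Qed.

Lemma boundaryD : {morph boundary : c d / c + d}.
Proof.
move=> c d; rewrite -[X in boundary (_ + X)]opprK boundaryB -[- d]sub0r.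
by rewrite boundaryB boundary0 sub0r opprK.
Qed.

Lemma boundaryZ a : {morph boundary : c / a *: c}.
Proof.
have bE (c : chain) :
    boundary c = \sum_(s <- dom c) coeff s c *: simplex_boundary s.
  rewrite -[in LHS](freeg_sumE c).
  rewrite (big_morph boundary boundaryD boundary0).
  by apply: eq_bigr => s _; rewrite /boundary liftU.
move=> c; have [->|a0] := eqVneq a 0; first by rewrite !scale0r boundary0.
rewrite !bE scaler_sumr (perm_big (dom c)) /=; last first.
  by apply: uniq_perm; rewrite ?uniq_dom//; exact: domZ.
by apply: eq_bigr => s _; rewrite coeffZ scalerA.
Qed.

Variables (K : simplicial_complex T) (k : nat).

Definition is_chain (j : nat) (c : chain) : Prop :=
  {in dom c, forall s, simplex K s /\ #|` s| = j.+1}.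

Lemma is_chain0 j : is_chain j 0.
Proof. by move=> s; rewrite dom0. Qed.

Lemma is_chain_lin j a c d :
  is_chain j c -> is_chain j d -> is_chain j (a *: c + d).
Proof.
move=> cj dj s /domD_subset; rewrite mem_cat => /orP[/domZ_subset|].
  exact: cj.
exact: dj.
Qed.

Definition cycles : {pred chain} :=
  fun c => `[< is_chain k c /\ boundary c = 0 >].

Lemma cycles_submod : submod_closed cycles.
Proof.
split=> [|a c d /asboolP[kc c0] /asboolP[kd d0]]; apply/asboolP.
  by split; [exact: is_chain0 | exact: boundary0].
split; first exact: is_chain_lin.
by rewrite boundaryD boundaryZ c0 d0 scaler0 addr0.
Qed.

HB.instance Definition _ := GRing.isSubmodClosed.Build F chain cycles
  cycles_submod.

Definition cycle_space : Type := {c : chain | c \in cycles}.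

HB.instance Definition _ := SubChoice.on cycle_space.
HB.instance Definition _ := [SubChoice_isSubLmodule of cycle_space by <:].

Definition boundaries : {pred cycle_space} :=
  fun z => `[< exists2 c, is_chain k.+1 c & boundary c = val z >].

Lemma boundaries_submod : submod_closed boundaries.
Proof.
split=> [|a y z /asboolP[c kc cy] /asboolP[d kd dz]]; apply/asboolP.
  by exists 0; [exact: is_chain0 | rewrite boundary0 raddf0].
exists (a *: c + d); first exact: is_chain_lin.
by rewrite boundaryD boundaryZ cy dz linearP.
Qed.

HB.instance Definition _ := GRing.isSubmodClosed.Build F cycle_space boundaries
  boundaries_submod.

Definition homology : lmodType F := quotient_module boundaries_submod.

End Homology.

Definition total_homology (F : fieldType) (T : choiceType)
    (K : simplicial_complex T) : lmodType F :=
  direct_sum (homology F K).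

Section Rips.
Variables (R : realType) (X : metricType R).

Definition totally_bounded : Prop :=
  forall e : R, 0 < e ->
    exists A : {fset X}, forall x : X, exists2 y, y \in A & mdist x y < e.

Definition is_rips_simplex (a : R) : set {fset X} :=
  [set s | s != fset0 /\ {in s &, forall x y, mdist x y < a}].

Lemma rips_neq0 a s : is_rips_simplex a s -> s != fset0.
Proof. by case. Qed.

Lemma rips_face a s t : is_rips_simplex a s -> t `<=` s -> t != fset0 ->
  is_rips_simplex a t.
Proof.
move=> [_ sa] /fsubsetP ts t0; split=> // x y /ts xs /ts ys.
exact: sa.
Qed.

Definition rips (a : R) : simplicial_complex X :=
  SimplicialComplex (@rips_neq0 a) (@rips_face a).

End Rips.

(* Main.v *)
Require Import Defs.
From HB Require Import structures.
From mathcomp Require Import all_boot all_order all_algebra finmap.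
From mathcomp Require Import generic_quotient ring_quotient freeg.
From mathcomp Require Import all_classical all_reals.
From mathcomp Require Import wochoice topology.

(** A totally bounded space X has a countable dense subset D. The point of the
    proof is that every homology class of the Rips complex of X contains a
    cycle with all its vertices in D; the chains on the countably many finite
    subsets of D then leave room for a countable basis only.

    To bring a cycle into D, its vertices are replaced one at a time. Let x be
    a vertex of the cycle z. Only finitely many simplices of z contain x, and
    the inequality d < a defining the open complex is strict, so there is some
    slack: any y of D close enough to x can be added to all of these simplices
    ([rips_dense]). Let D_v remove the vertex v from a simplex (giving 0 if it
    is absent) and let J_v add it (giving 0 if it is present), with the signs
    given by the orientation. These are the contraction and exterior product
    operators of an exterior algebra, so the operators D_v anticommute and
    D_v J_w + J_w D_v is the identity or 0 according to whether v = w. The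
    boundary, with the empty simplex admitted as a face, is the sum of the D_v;
    it follows that it anticommutes with each D_v, and that each J_v is a
    contracting homotopy for it ([aug_contract], [aug_cone]). If z is a cycle,
    so is its link D_x z at x, and
      z' = z - J_x D_x z + J_y D_x z,
    which is z with x moved to y, differs from z by the boundary of
    J_y J_x D_x z. This chain lives on the simplices of z containing x, with y
    added to them, hence in the complex ([move_vertex_homologous]). Working
    with one vertex at a time avoids simplicial maps and the prism operator.

    For the count, number the finite subsets of D and filter the total homology
    by the classes represented by cycles in each degree that only use simplices
    numbered below n. Passing from n to n + 1 allows one more simplex, in one
    degree, so each step raises the dimension by at most one, and choosing one
    vector at each jump gives a basis indexed by a set of integers
    ([filtration_countable_basis]). *)

Set Implicit Arguments.
Unset Strict Implicit.
Unset Printing Implicit Defensive.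

Import Order.TTheory GRing.Theory Num.Theory.

Local Open Scope classical_set_scope.
Local Open Scope quotient_scope.
Local Open Scope fset_scope.
Local Open Scope ring_scope.

(** * Countable bases from filtrations *)

Section FiltrationBasis.
Variables (F : fieldType) (V : lmodType F) (U : nat -> set V).
Hypothesis U0 : forall n, U n 0.
Hypothesis Ulin : forall n a u v, U n u -> U n v -> U n (a *: u + v).
Hypothesis Ubot : forall v, U 0%N v -> v = 0.
Hypothesis Umono : forall n v, U n v -> U n.+1 v.
Hypothesis Uexh : forall v, exists n, U n v.
Hypothesis Ustep : forall n u v, U n.+1 u -> ~ U n u -> U n.+1 v ->
  exists a, U n (v - a *: u).

Let Ule m n v : (m <= n)%N -> U m v -> U n v.
Proof.
move=> /subnK <-; elim: (n - m)%N => // k IH /IH.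
by rewrite addSn; exact: Umono.
Qed.

Let Uscale n a v : U n v -> U n (a *: v).
Proof. by move=> Uv; rewrite -[_ *: _]addr0; exact: Ulin. Qed.

Let Usum n (s : seq V) (c : V -> F) :
  {in s, forall w, U n (c w *: w)} -> U n (\sum_(w <- s) c w *: w).
Proof.
elim: s => [|w s IH] sU; first by rewrite big_nil.
rewrite big_cons -[c w *: w]scale1r; apply: Ulin.
  by apply: sU; rewrite mem_head.
by apply: IH => v vs; apply: sU; rewrite inE vs orbT.
Qed.

(** At each jump from U n to U n.+1 pick one vector. The picked vectors span by
    induction on the filtration. In a vanishing combination, the term of
    highest level would lie one step lower in the filtration than it does. *)
Lemma filtration_countable_basis : has_countable_basis V.
Proof.
pose jump n v := U n.+1 v /\ ~ U n v.
have /choice[f fP] n : exists u, (exists v, jump n v) -> jump n u.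
  have [[u ju]|nj] := pselect (exists v, jump n v); first by exists u.
  by exists 0 => /nj.
exists (f @` [set n | jump n (f n)])%classic; split.
  by apply: card_le_trans (card_image_le _ _) _; exact: countableP.
split.
- move=> s c us sB s0 v vs; apply/eqP; apply/negPn/negP => cv.
  have /choice[lev levP] w : exists n, w \in s -> jump n w /\ w = f n.
    have [/sB[n jn <-]|] := boolP (w \in s); first by exists n.
    by exists 0%N.
  have levI w w' : w \in s -> w' \in s -> lev w = lev w' -> w = w'.
    by move=> /levP[_ {2}->] /levP[_ {2}->] ->.
  have [w [ws cw wmax]] : exists w, [/\ w \in s, c w != 0 &
      forall w', w' \in s -> c w' != 0 -> (lev w' <= lev w)%N].
    pose P n := `[< exists w, [/\ w \in s, c w != 0 & lev w = n] >].
    have exP : exists n, P n by exists (lev v); apply/asboolP; exists v.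
    have bP n : P n -> (n <= \max_(w <- s) lev w)%N.
      by move=> /asboolP[w [ws _ <-]]; exact: leq_bigmax_seq.
    case: (ex_maxnP exP bP) => n /asboolP[w [ws cw <-]] nmax.
    exists w; split=> // w' w's cw'; apply: nmax; apply/asboolP.
    by exists w'.
  have [[_ nUw] _] := levP w ws; apply: nUw.
  have wE : w = - (c w)^-1 *: \sum_(u <- s | u != w) c u *: u.
    move: s0; rewrite (bigD1_seq w)//= => /eqP; rewrite addr_eq0 => /eqP s0.
    by rewrite scaleNr -scalerN -s0 scalerA mulVf// scale1r.
  rewrite [X in U _ X]wE -big_filter; apply: Uscale; apply: Usum => u.
  rewrite mem_filter => /andP[uw us'].
  have [->|cu] := eqVneq (c u) 0; first by rewrite scale0r.
  apply: Uscale.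
  have [[uU _] _] := levP u us'; apply: Ule uU.
  by rewrite ltn_neqAle wmax// andbT; apply: contra uw => /eqP /levI->.
- move=> v; have [n] := Uexh v.
  (* The picked vector of level n is not in U n; strengthening the statement
     with membership in U n makes it fresh, so that its coefficient can be set
     without disturbing the others. *)
  suff : U n v -> exists (s : seq V) (c : V -> F),
      {in s, forall w, U n w /\ (f @` [set n | jump n (f n)])%classic w} /\
      v = \sum_(w <- s) c w *: w.
    by move=> H /H[s [c [sB ->]]]; exists s, c; split=> // w /sB[].
  elim: n v => [v /Ubot ->|n IH v vn].
    by exists [::], (fun=> 0); split=> //; rewrite big_nil.
  have [Uv|nUv] := pselect (U n v).
    have [s [c [sB ->]]] := IH v Uv; exists s, c; split=> // w /sB[Uw Bw].
    by split=> //; exact: Umono.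
  have jn : jump n (f n) by apply: fP; exists v.
  have [Ufn nUfn] := jn; have [a /IH[s [c [sB vE]]]] := Ustep Ufn nUfn vn.
  exists (f n :: s), (fun w => if w == f n then a else c w); split.
    move=> w; rewrite inE => /predU1P[->|/sB[/Umono ? ?]//].
    by split=> //; exists n.
  rewrite big_cons eqxx; apply/eqP; rewrite addrC -subr_eq vE; apply/eqP.
  rewrite !big_seq; apply: eq_bigr => w /sB[Uw _].
  by case: eqP Uw => // ->.
Qed.
End FiltrationBasis.

(** * The exterior algebra operators on chains *)

Section Chains.
Variables (F : fieldType) (T : choiceType).
Local Notation chain := {freeg {fset T} / F}.
Implicit Types (s t : {fset T}) (v w x y : T) (c d z : chain).

Lemma freegUZ a s : << a *g s >> = a *: << s >> :> chain.
Proof. by apply/eqP/freeg_eqP => t; rewrite coeffZ !coeffU mul1r. Qed.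

Lemma chain_ind (P : chain -> Prop) :
  P 0 -> (forall a s c, P c -> P (a *: << s >> + c)) -> forall c, P c.
Proof.
move=> P0 PD c; rewrite -[c]freeg_sumE.
elim: (dom c) => [|s ss IH]; first by rewrite big_nil.
by rewrite big_cons freegUZ; exact: PD.
Qed.

Lemma fglift_is_linear (f : {fset T} -> chain) :
  linear (fglift f : chain -> chain).
Proof.
have fB := lift_is_additive f.
have f0 : fglift f 0 = 0 by rewrite -[X in fglift f X](subrr 0) fB subrr.
have fD : {morph fglift f : c d / c + d}.
  move=> c d; rewrite -[X in fglift f (_ + X)]opprK fB -[- d]sub0r.
  by rewrite fB f0 sub0r opprK.
have fE (c : chain) : fglift f c = \sum_(s <- dom c) coeff s c *: f s.
  rewrite -[in LHS](freeg_sumE c) (big_morph (fglift f) fD f0).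
  by apply: eq_bigr => s _; rewrite liftU.
move=> a c d; rewrite fD; congr (_ + _).
have [->|a0] := eqVneq a 0; first by rewrite !scale0r f0.
rewrite !fE scaler_sumr (perm_big (dom c)) /=; last first.
  by apply: uniq_perm; rewrite ?uniq_dom//; exact: domZ.
by apply: eq_bigr => s _; rewrite coeffZ scalerA.
Qed.

HB.instance Definition _ f :=
  GRing.isLinear.Build F chain chain _ (fglift f) (fglift_is_linear f).

Definition index_sign s v : F := (-1) ^+ vertex_index s v.

(** The interior product D_v: up to sign, the link of v in the chain. *)
Definition contract v : chain -> chain :=
  fglift (fun s => if v \in s then index_sign s v *: << s `\ v >> else 0).
HB.instance Definition _ v := GRing.Linear.on (contract v).

(** The exterior product J_v. A simplex containing v is sent to 0, as a
    degenerate simplex would be. *)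
Definition cone v : chain -> chain :=
  fglift (fun s => if v \in s then 0 else index_sign s v *: << v |` s >>).
HB.instance Definition _ v := GRing.Linear.on (cone v).

Lemma contractU v s :
  contract v << s >> = if v \in s then index_sign s v *: << s `\ v >> else 0.
Proof. by rewrite /contract liftU scale1r. Qed.

Lemma coneU v s :
  cone v << s >> = if v \in s then 0 else index_sign s v *: << v |` s >>.
Proof. by rewrite /cone liftU scale1r. Qed.

(** The augmented boundary: it sends a vertex to the empty simplex, where
    [boundary] gives 0. With it, the identities below hold in all degrees. *)
Definition aug_boundary : chain -> chain :=
  fglift (fun s => \sum_(v <- s) contract v << s >>).
HB.instance Definition _ := GRing.Linear.on aug_boundary.

Lemma vertex_leNge v w : v != w -> vertex_le w v = ~~ vertex_le v w.
Proof.
have wo : wo_chain (@vertex_le T) predT.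
  by apply: withinW; exact: svalP (well_ordering_principle T).
move=> vw; have := wo_chainW wo (x := v) (y := w) isT isT.
have := wo_chain_antisymmetric wo (x := v) (y := w) isT isT.
case: (vertex_le v w); case: (vertex_le w v) => //= /(_ isT) vwE.
by rewrite vwE eqxx in vw.
Qed.

Lemma vertex_index_add s v w : w \notin s ->
  vertex_index (w |` s) v = ((w != v) && vertex_le w v + vertex_index s v)%N.
Proof.
move=> ws; rewrite /vertex_index.
set A := [fset u in s | _]; set B := [fset u in w |` s | _].
have BE u : u \in B = (u == w) && ((w != v) && vertex_le w v) || (u \in A).
  by rewrite !inE /=; case: eqVneq => //= ->; rewrite (negbTE ws) /= orbF.
have wA : w \notin A by rewrite !inE /= (negbTE ws).
case: (_ && _) BE => BE.
  suff -> : B = w |` A by rewrite cardfsU1 wA.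
  by apply/fsetP => u; rewrite BE andbT in_fset1U.
by rewrite add0n; congr #|` _|; apply/fsetP => u; rewrite BE andbF.
Qed.

Lemma vertex_index_self s v : vertex_index (v |` s) v = vertex_index s v.
Proof.
have [vs|vs] := boolP (v \in s); last by rewrite vertex_index_add// eqxx.
by rewrite mem_fset1U.
Qed.

Lemma index_sign_self s v : index_sign (v |` s) v = index_sign s v.
Proof. by rewrite /index_sign vertex_index_self. Qed.

Lemma index_signD1 s v : index_sign (s `\ v) v = index_sign s v.
Proof.
have [vs|vs] := boolP (v \in s); last by rewrite mem_fsetD1.
by rewrite -index_sign_self fsetD1K.
Qed.

Lemma index_signK s v (c : chain) :
  index_sign s v *: (index_sign s v *: c) = c.
Proof. by rewrite scalerA -expr2 sqrr_sign scale1r. Qed.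

(** Adding w to a simplex shifts the index of v when w < v, and adding v shifts
    the index of w when v < w. Exactly one of these happens, hence the sign
    here, for adding one vertex and removing the other, and in
    [index_sign_swap], for removing both. *)
Lemma index_sign_link s v w : v != w -> v \notin s -> w \notin s ->
  index_sign (w |` s) v * index_sign (v |` s) w =
  - (index_sign s v * index_sign s w).
Proof.
move=> vw vs ws; rewrite /index_sign !vertex_index_add// [w == v]eq_sym vw /=.
by rewrite (vertex_leNge vw); case: (vertex_le v w);
  rewrite /= add0n add1n exprS mulN1r ?mulrN ?mulNr.
Qed.

Lemma index_sign_swap s v w : v != w -> v \notin s -> w \notin s ->
  index_sign (w |` s) v * index_sign s w =
  - (index_sign (v |` s) w * index_sign s v).
Proof.
move=> vw vs ws; rewrite /index_sign !vertex_index_add// [w == v]eq_sym vw /=.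
by rewrite (vertex_leNge vw) mulrC; case: (vertex_le v w);
  rewrite /= add0n add1n exprS mulN1r ?mulrN ?mulNr ?opprK // mulrC.
Qed.

(** Any large enough set of vertices may index the sum. This lets the same sum
    be used for a simplex and for its images under the operators. *)
Lemma aug_boundary_sub s t : s `<=` t ->
  aug_boundary << s >> = \sum_(v <- t) contract v << s >>.
Proof.
move=> st; rewrite /aug_boundary liftU scale1r.
by apply: big_fset_incl => // v _ vs; rewrite contractU (negbTE vs).
Qed.

Lemma contractC v w c : contract v (contract w c) = - contract w (contract v c).
Proof.
elim/chain_ind: c => [|a s c IH]; first by rewrite !linear0.
rewrite !linearP/= IH; congr (_ *: _ + _) => {a c IH}.
have [<-|vw] := eqVneq v w.
  rewrite contractU; case: ifP => vs; last by rewrite linear0 oppr0.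
  by rewrite linearZ/= contractU !inE eqxx/= scaler0 oppr0.
rewrite !contractU.
have [vs|vs] := boolP (v \in s); have [ws|ws] := boolP (w \in s).
- rewrite !linearZ/= !contractU !inE vs ws vw eq_sym vw /=.
  have swap : s `\ v `\ w = s `\ w `\ v by rewrite !fsetDDl fsetUC.
  rewrite swap ?scalerN !scalerA -scaleNr; congr (_ *: _).
  set t := s `\ w `\ v.
  have wE : s `\ w = v |` t by rewrite fsetD1K// !inE vw.
  have vE : s `\ v = w |` t.
    by rewrite /t -swap fsetD1K// !inE eq_sym vw.
  have [vt wt] : v \notin t /\ w \notin t by rewrite !inE !eqxx andbF.
  rewrite -(index_signD1 s w) -(index_signD1 s v) vE wE !index_sign_self.
  by rewrite index_sign_swap// eq_sym.
- by rewrite linear0 linearZ/= contractU !inE (negbTE ws) andbF scaler0 oppr0.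
- by rewrite linear0 linearZ/= contractU !inE (negbTE vs) andbF scaler0 oppr0.
- by rewrite !linear0.
Qed.

(** The Clifford relation between the exterior and interior products. *)
Lemma contract_cone v w c :
  contract v (cone w c) + cone w (contract v c) = (v == w)%:R *: c.
Proof.
elim/chain_ind: c => [|a s c IH]; first by rewrite !linear0 addr0.
rewrite !linearP/= addrACA IH -scalerDr; congr (_ *: _ + _) => {a c IH}.
have [<-|vw] := eqVneq v w.
  rewrite scale1r coneU contractU; have [vs|vs] := boolP (v \in s).
    rewrite linear0 add0r linearZ/= coneU !inE eqxx/= fsetD1K//.
    by rewrite index_signD1 index_signK.
  rewrite linear0 addr0 linearZ/= contractU fset1U1 index_sign_self index_signK.
  by rewrite fsetU1K.
rewrite scale0r coneU contractU.
have [vs|vs] := boolP (v \in s); have [ws|ws] := boolP (w \in s).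
- by rewrite linear0 add0r linearZ/= coneU !inE eq_sym vw ws scaler0.
- rewrite !linearZ/= contractU coneU !inE vs orbT (negbTE ws) andbF !scalerA.
  set t := s `\ v; have sE : s = v |` t by rewrite fsetD1K.
  have vt : v \notin t by rewrite !inE eqxx.
  have wt : w \notin t by rewrite !inE (negbTE ws) andbF.
  have -> : (w |` s) `\ v = w |` t.
    apply/fsetP => u; rewrite !inE.
    by case: eqVneq => //= ->; rewrite (negbTE vw).
  rewrite -scalerDl sE fsetUCA !index_sign_self.
  by rewrite mulrC index_sign_link ?addNr ?scale0r// eq_sym.
- by rewrite !linear0 addr0.
- rewrite linear0 addr0 linearZ/= contractU !inE (negbTE vs) (negbTE vw).
  by rewrite scaler0.
Qed.

(** The augmented boundary is the sum of the interior products, which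
    anticommute. In particular the link of a vertex in a cycle is a cycle. *)
Lemma aug_contract v c :
  aug_boundary (contract v c) = - contract v (aug_boundary c).
Proof.
elim/chain_ind: c => [|a s c IH]; first by rewrite !linear0.
rewrite !linearP/= IH; congr (_ *: _ + _) => {a c IH}.
have -> : aug_boundary (contract v << s >>) =
    \sum_(w <- s) contract w (contract v << s >>).
  rewrite contractU; case: ifP => vs; last first.
    by rewrite linear0 big1// => w _; rewrite linear0.
  rewrite linearZ/= (@aug_boundary_sub _ s) ?fsubD1set// scaler_sumr.
  by apply: eq_bigr => w _; rewrite linearZ.
rewrite (@aug_boundary_sub s s)// linear_sum/= -sumrN.
by apply: eq_bigr => w _; exact: contractC.
Qed.

(** Sum of the Clifford relations over the first vertex: the cone with apex v is
    a contracting homotopy. *)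
Lemma aug_cone v c : aug_boundary (cone v c) = c - cone v (aug_boundary c).
Proof.
elim/chain_ind: c => [|a s c IH]; first by rewrite !linear0 addr0.
rewrite !linearP/= IH addrACA -scalerDr; congr (_ *: _ + _) => {a c IH}.
apply/eqP; rewrite -subr_eq opprK; apply/eqP.
have -> : aug_boundary (cone v << s >>) =
    \sum_(w <- v |` s) contract w (cone v << s >>).
  rewrite coneU; case: ifP => vs.
    by rewrite linear0 big1// => w _; rewrite linear0.
  rewrite linearZ/= (@aug_boundary_sub _ (v |` s))// scaler_sumr.
  by apply: eq_bigr => w _; rewrite linearZ.
rewrite (@aug_boundary_sub s (v |` s)) ?fsubsetU1// linear_sum/= -big_split/=.
under eq_bigr do rewrite contract_cone.
rewrite (bigD1_seq v) ?fset1U1 ?fset_uniq//= eqxx scale1r big1 ?addr0//.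
by move=> w /negbTE ->; rewrite scale0r.
Qed.

(** * Moving a vertex of a cycle *)

Lemma linear_chainE (f : {linear chain -> chain}) c :
  f c = \sum_(s <- dom c) coeff s c *: f << s >>.
Proof.
rewrite -[in LHS](freeg_sumE c) linear_sum; apply: eq_bigr => s _.
by rewrite -linearZ freegUZ.
Qed.

Lemma dom_linear (f : {linear chain -> chain}) (P : set {fset T}) c :
  {in dom c, forall s, {in dom (f << s >>), forall t, P t}} ->
  {in dom (f c), forall t, P t}.
Proof.
move=> fP t; rewrite linear_chainE => /dom_sum_subset/flattenP[r /mapP[s]].
by rewrite filter_predT => sc -> /domZ_subset; exact: fP sc _.
Qed.

Lemma domZU a s t : t \in dom (a *: << s >> : chain) -> t = s.
Proof. by move=> /domZ_subset; rewrite domU1 inE => /eqP. Qed.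

Lemma simplex_boundaryE s : simplex_boundary F s =
  if (#|` s| <= 1)%N then 0 else aug_boundary << s >>.
Proof.
rewrite /simplex_boundary; case: ifP => // _.
rewrite (aug_boundary_sub (fsubset_refl s)) !big_seq.
by apply: eq_bigr => v vs; rewrite contractU vs.
Qed.

Lemma boundary_aug c : {in dom c, forall s, 1 < #|` s|}%N ->
  boundary c = aug_boundary c.
Proof.
move=> c1; rewrite /boundary linear_chainE [RHS]linear_chainE !big_seq.
apply: eq_bigr => s /c1 s1.
by rewrite /= liftU scale1r simplex_boundaryE leqNgt s1.
Qed.

Lemma boundary_vertices c :
  {in dom c, forall s, #|` s| <= 1}%N -> boundary c = 0.
Proof.
move=> c1; rewrite /boundary linear_chainE big_seq big1// => s /c1 s1.
by rewrite /= liftU simplex_boundaryE s1 !scaler0.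
Qed.

(** As x added to a simplex containing it gives 0, only one term of the Clifford
    relation for v = w = x survives. *)
Lemma cone_contractU x s :
  cone x (contract x << s >>) = if x \in s then << s >> else 0 :> chain.
Proof.
have := contract_cone x x (<< s >> : chain).
rewrite coneU eqxx scale1r contractU; case: ifP => _; last by rewrite !linear0.
by rewrite linear0 add0r.
Qed.

(** The simplices containing x are replaced by the cone with apex y over the
    link of x; the others are kept. *)
Definition move_vertex x y : chain -> chain :=
  (idfun \- (cone x \o contract x)) \+ (cone y \o contract x).
HB.instance Definition _ x y := GRing.Linear.on (move_vertex x y).

Lemma dom_move_vertexU x y s :
  {in dom (move_vertex x y << s >>), forall t,
    (x \notin s /\ t = s) \/ [/\ x \in s, y \notin s `\ x & t = y |` (s `\ x)]}.
Proof.
move=> t; rewrite /move_vertex/= cone_contractU contractU.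
case: ifPn => xs; last first.
  by rewrite !linear0 !addr0 domU1 mem_seq1 => /eqP ->; left.
rewrite subrr add0r linearZ/= coneU; case: ifPn => ys.
  by rewrite scaler0 dom0.
by rewrite scalerA => /domZU; right.
Qed.

Lemma dom_cone_contractU x y s :
  {in dom (cone y (cone x (contract x << s >> : chain))), forall t,
    [/\ x \in s, y \notin s & t = y |` s]}.
Proof.
move=> t; rewrite cone_contractU; case: ifPn => xs.
  by rewrite coneU; case: ifPn => ys; [rewrite dom0|move=> /domZU].
by rewrite linear0 dom0.
Qed.

(** With c the link D_x z, a cycle, the homotopy formula applied twice gives
      d (J_y J_x c) = J_x c - J_y (c - J_x (d c)) = J_x c - J_y c = z - z'. *)
Lemma move_vertex_homologous (K : simplicial_complex T) k x y z :
  is_chain K k z -> boundary z = 0 ->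
  {in dom z, forall s, x \in s -> simplex K (y |` s)} ->
  let z' := move_vertex x y z in
  [/\ is_chain K k z', boundary z' = 0 &
    exists2 w, is_chain K k.+1 w & boundary w = z - z'].
Proof.
move=> kz z0 yK z'.
have kz' : is_chain K k z'.
  apply: dom_linear => s sz t /dom_move_vertexU[[_ ->]|[xs ys ->]].
    exact: kz.
  have [sK sk] := kz s sz; split.
    apply: (simplex_face (yK s sz xs)); first exact/fsetUS/fsubD1set.
    by apply/fset0Pn; exists y; rewrite fset1U1.
  by rewrite cardfsU1 ys -sk (cardfsD1 x s) xs.
pose w := cone y (cone x (contract x z)).
have kw : is_chain K k.+1 w.
  apply: (@dom_linear (cone y \o cone x \o contract x)) => s sz t.
  move=> /dom_cone_contractU[xs ys ->]; split; first exact: yK.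
  by rewrite cardfsU1 ys (kz s sz).2.
have c0 : aug_boundary (contract x z) = 0.
  (* In degree 0 the augmented boundary of z need not vanish, but the link is
     then a multiple of the empty simplex. *)
  have [k0|k0] := posnP k; last first.
    rewrite aug_contract -boundary_aug ?z0 ?linear0// => s /kz[_ ->].
    by rewrite ltnS.
  rewrite linear_chainE; rewrite big_seq big1// => s scz.
  suff -> : s = fset0.
    rewrite /= (aug_boundary_sub (fsubset_refl fset0)) big_seq_fset0.
    by rewrite scaler0.
  move: s scz; apply: (@dom_linear (contract x)) => s sz t /=.
  rewrite contractU.
  case: ifPn => xs; last by rewrite dom0.
  move=> /domZU ->; apply/eqP; rewrite -cardfs_eq0.
  by have := (kz s sz).2; rewrite (cardfsD1 x s) xs k0 => -[/eqP].
have wE : aug_boundary w = z - z'.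
  rewrite /w !aug_cone c0 linear0 subr0 /z' /move_vertex/=.
  by rewrite !opprD opprK addrA addrA subrr add0r.
have bw : boundary w = aug_boundary w.
  by apply: boundary_aug => s /kw[_ ->].
split=> //; last by exists w => //; rewrite bw.
have [k0|k0] := posnP k.
  by apply: boundary_vertices => s /kz'[_ ->]; rewrite k0.
have ba c : is_chain K k c -> boundary c = aug_boundary c.
  by move=> kc; apply: boundary_aug => s /kc[_ ->]; rewrite ltnS.
rewrite ba// /z' /move_vertex/= linearD linearB/= -(ba z)// z0 !aug_cone c0.
by rewrite !linear0 ?subr0 !addr0 sub0r addNr.
Qed.
End Chains.

(** * Representing homology classes on a dense set of vertices *)

Section Dense.
Variables (F : fieldType) (T : choiceType) (K : simplicial_complex T).
Local Notation chain := {freeg {fset T} / F}.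

(** Density of D as seen by the complex: this is all that moving a vertex x of a
    cycle into D requires, with ss the simplices of the cycle that contain x. *)
Definition dense_vertices (D : set T) : Prop :=
  forall (x : T) (ss : seq {fset T}),
    {in ss, forall s, simplex K s /\ x \in s} ->
    exists2 y, D y & {in ss, forall s, simplex K (y |` s)}.

Definition vertices_in (D : set T) (c : chain) : Prop :=
  {in dom c, forall s, {in s, forall v, D v}}.

Definition hclass k (z : cycle_space F K k) : homology F K k :=
  \pi_(quotient_module (boundaries_submod F K k)) z.

Lemma hclass_lin k a (u v : cycle_space F K k) :
  hclass (a *: u + v) = a *: hclass u + hclass v.
Proof.
rewrite /hclass -Defs.pi_add; congr (_ + _).
exact: esym (Defs.pi_scale _ a u).
Qed.

Lemma hclass0 k : hclass (0 : cycle_space F K k) = 0.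
Proof.
have := hclass_lin (-1) (0 : cycle_space F K k) 0.
by rewrite scaler0 addr0 scaleN1r addNr.
Qed.

Lemma hclass_surj k (h : homology F K k) : exists z, hclass z = h.
Proof. by exists (repr h); rewrite /hclass reprK. Qed.

Lemma eq_hclass k (u v : cycle_space F K k) (w : chain) :
  is_chain K k.+1 w -> boundary w = val u - val v -> hclass u = hclass v.
Proof.
move=> kw bw; apply/eqP; rewrite /hclass -Quotient.idealrBE; apply/asboolP.
by exists w => //; rewrite bw raddfB.
Qed.

(** The vertices outside D, kept in a list, are moved into D one by one. *)
Lemma hclass_dense D k (h : homology F K k) : dense_vertices D ->
  exists2 z, hclass z = h & vertices_in D (val z).
Proof.
move=> dD.
suff H (xs : seq T) : forall z : cycle_space F K k,
    vertices_in (fun v => D v \/ v \in xs) (val z) ->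
    exists2 z', hclass z' = hclass z & vertices_in D (val z').
  have [z zh] := hclass_surj h.
  have [|z' z'z z'D] := H (flatten [seq enum_fset s | s <- dom (val z)]) z.
    move=> s sz v vs; right; apply/flattenP; exists (enum_fset s) => //.
    exact: map_f.
  by exists z' => //; rewrite z'z.
elim: xs => [|x xs IH] z zxs.
  by exists z => // s /zxs sD v /sD[].
have /asboolP[kz z0] := valP z.
have [|y Dy yK] := dD x [seq s <- dom (val z) | x \in s].
  by move=> s; rewrite mem_filter => /andP[xs' /kz[]].
have [|kz' z'0 [w kw bw]] := @move_vertex_homologous _ _ K k x y (val z) kz z0.
  by move=> s sz xs'; apply: yK; rewrite mem_filter xs'.
have cz' : move_vertex x y (val z) \in cycles (F := F) K k by apply/asboolP.
pose z' : cycle_space F K k := exist (fun c : chain => c \in cycles K k) _ cz'.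
have -> : hclass z = hclass z' by apply: (eq_hclass kw).
apply: IH; apply: dom_linear => s sz t.
have sxs := zxs s sz.
move=> /dom_move_vertexU[[xs' ->] v vs|[xs' ys ->] v].
  have [|] := sxs v vs; first by left.
  rewrite inE => /predU1P[vx|]; last by right.
  by rewrite -vx vs in xs'.
rewrite !inE => /predU1P[->|/andP[vx /sxs[]]]; [by left|by left|].
by rewrite inE (negbTE vx) /= => ?; right.
Qed.
End Dense.

(** * The filtration of the total homology *)

Section Countable.
Variables (F : fieldType) (T : choiceType) (K : simplicial_complex T).
Local Notation chain := {freeg {fset T} / F}.

Lemma countable_simplex_code (D : set T) : countable D ->
  exists code : {fset T} -> nat, forall s t : {fset T},
    {in s, forall v, D v} -> {in t, forall v, D v} -> code s = code t -> s = t.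
Proof.
move=> /countable_injP[e einj].
exists (fun s : {fset T} =>
  @choice.pickle {fset nat} (e @` s)%fset) => s t sD tD.
move=> /(pcan_inj (@choice.pickleK {fset nat})) st.
suff sub (s' t' : {fset T}) : {in s', forall v, D v} ->
    {in t', forall v, D v} -> (e @` s' = e @` t')%fset -> s' `<=` t'.
  by apply/eqP; rewrite eqEfsubset !sub.
move=> s'D t'D st'; apply/fsubsetP => v vs'.
have : e v \in (e @` t')%fset by rewrite -st' in_imfset.
move=> /imfsetP[w /= wt' /einj ->//]; rewrite inE; [exact: s'D|exact: t'D].
Qed.

(** Filter by the classes with representatives, in every degree, using only
    simplices on D of code less than n. If u is at level n + 1 but not at level
    n, its representative in some degree k has a nonzero coefficient on the
    simplex s0 of code n, which therefore has dimension k; subtracting a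
    multiple of u then removes s0 from any other class of level n + 1, and the
    degrees other than k are not concerned. *)
Lemma total_homology_countable_basis (D : set T) :
  countable D -> dense_vertices K D -> has_countable_basis (total_homology F K).
Proof.
move=> /countable_simplex_code[code code_inj] dD.
pose coded n (c : chain) := {in dom c, forall s, (code s < n)%N}.
pose U n : set (total_homology F K) := fun h => forall k,
  exists z, [/\ hclass z = val h k, vertices_in D (val z) & coded n (val z)].
have good0 k n : exists z : cycle_space F K k,
    [/\ hclass z = 0, vertices_in D (val z) & coded n (val z)].
  exists 0; split; last 2 first.
  - by move=> s; rewrite raddf0 dom0.
  - by move=> s; rewrite raddf0 dom0.
  exact: hclass0.
have domL k a (u v : cycle_space F K k) s : s \in dom (val (a *: u + v)) ->
    s \in dom (val u) \/ s \in dom (val v).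
  rewrite linearP => /domD_subset; rewrite mem_cat.
  by move=> /orP[/domZ_subset|]; [left|right].
apply: (@filtration_countable_basis _ _ U).
- by move=> n k; exact: good0.
- move=> n a u v Uu Uv k.
  have [[zu [uE uD un]] [zv [vE vD vn]]] := (Uu k, Uv k).
  exists (a *: zu + zv); split.
  + by rewrite hclass_lin uE vE.
  + by move=> s /domL[/uD|/vD].
  + by move=> s /domL[/un|/vn].
- move=> h Uh; apply: val_inj; apply: functional_extensionality_dep => k.
  have [z [<- _ z0]] := Uh k.
  have -> : z = 0.
    apply: val_inj; apply/eqP; rewrite raddf0 -dom_eq0.
    by move: z0; rewrite /coded; case: (dom _) => // s ss /(_ s (mem_head _ _)).
  exact: hclass0.
- move=> n h Uh k; have [z [zE zD zn]] := Uh k; exists z; split=> // s /zn.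
  exact: leqW.
- move=> h; have /choice[N NP] k : exists n, exists z,
      [/\ hclass z = val h k, vertices_in D (val z) & coded n (val z)].
    have [z zE zD] := hclass_dense (val h k) dD.
    exists (\max_(s <- dom (val z)) (code s).+1)%N, z; split=> // s sz.
    exact: (@leq_bigmax_seq _ _ xpredT (fun s => (code s).+1)).
  have /asboolP[m mP] := valP h.
  exists (\max_(k < m) N k)%N => k; have [km|mk] := ltnP k m; last first.
    (* above the support of h the zero cycles are needed for a common bound *)
    by rewrite mP//; exact: good0.
  have [z [zE zD zN]] := NP k; exists z; split=> // s /zN sN.
  exact: leq_trans sN (leq_bigmax (Ordinal km)).
- move=> n u v Uu /existsNP[k uk] Uv.
  have [zu [zuE zuD zun]] := Uu k.
  have [s0 s0zu s0n] : exists2 s, s \in dom (val zu) & code s = n.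
    apply: contrapT => none; apply: uk; exists zu; split=> // s sz.
    rewrite ltn_neqAle -ltnS zun// andbT; apply/eqP => sn.
    by apply: none; exists s.
  have s0E t : {in t, forall w, D w} -> code t = n -> t = s0.
    by move=> tD tn; apply: code_inj => //; [exact: zuD|rewrite tn].
  have card k' (z : cycle_space F K k') s :
      s \in dom (val z) -> #|` s| = k'.+1.
    by have /asboolP[kz _] := valP z => /kz[].
  have [zv [zvE zvD zvn]] := Uv k.
  pose a := coeff s0 (val zv) / coeff s0 (val zu); exists a => k'.
  have -> : val (v - a *: u) k' = - a *: val u k' + val v k'.
    by rewrite addrC -scaleNr.
  suff [zu' [zv' [zuE' zvE' [zuD' zvD'] [zun' zvn'] s0z]]] :
      exists zu' zv' : cycle_space F K k', [/\ hclass zu' = val u k',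
        hclass zv' = val v k',
        vertices_in D (val zu') /\ vertices_in D (val zv'),
        coded n.+1 (val zu') /\ coded n.+1 (val zv') &
        s0 \notin dom (val (- a *: zu' + zv'))].
    exists (- a *: zu' + zv'); split.
    + by rewrite hclass_lin zuE' zvE'.
    + by move=> s /domL[/zuD'|/zvD'].
    + move=> s sz; have sn : (code s < n.+1)%N.
        by case: (domL _ _ _ _ _ sz) => [/zun'|/zvn'].
      rewrite ltn_neqAle -ltnS sn andbT; apply: contra s0z => /eqP sn'.
      by rewrite -(s0E s)//; case: (domL _ _ _ _ _ sz) => [/zuD'|/zvD'].
  have [<-{k'}|kk'] := eqVneq k k'.
    exists zu, zv; split=> //; rewrite mem_dom negbK linearP/= coeffD coeffZ.
    by rewrite mulNr divfK ?addNr// -mem_dom.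
  have [[zu' [zuE' zuD' zun']] [zv' [zvE' zvD' zvn']]] := (Uu k', Uv k').
  exists zu', zv'; split=> //; apply: contra kk' => /card.
  by rewrite (card _ _ _ s0zu) => -[->].
Qed.
End Countable.

(** * Rips complexes *)

Section Separable.
Local Open Scope classical_set_scope.
Variables (R : realType) (X : metricType R).

Lemma totally_bounded_separable : totally_bounded X ->
  exists2 D : set X, countable D &
    forall x e, 0 < e -> exists2 y, D y & mdist x y < e.
Proof.
move=> tb; have /choice[A AP] n : exists A : {fset X}, forall x : X,
    exists2 y, y \in A & mdist x y < n.+1%:R^-1.
  by apply: tb; rewrite invr_gt0.
exists (\bigcup_n [set` A n]).
  by apply: bigcup_countable => // n _; exact: countable_fset.
move=> x e e0; have [n ne] : exists n, n.+1%:R^-1 < e.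
  exists (Num.truncn e^-1); rewrite invf_plt ?posrE//; exact: truncnS_gt.
have [y yA xy] := AP n x; exists y; first by exists n.
exact: lt_trans ne.
Qed.

Lemma uniform_slack (I : eqType) (r : seq I) (f : I -> R) (a : R) :
  {in r, forall i, f i < a} ->
  exists2 e, 0 < e & {in r, forall i, f i + e <= a}.
Proof.
elim: r => [|i r IH] ra; first by exists 1.
have [|e e0 eP] := IH; first by move=> j jr; apply: ra; rewrite inE jr orbT.
exists (Num.min e (a - f i)).
  by rewrite lt_min e0 subr_gt0 ra// mem_head.
move=> j; rewrite inE => /predU1P[->|/eP]; rewrite -!lerBrDl ge_min.
  by rewrite lexx orbT.
by move=> ->.
Qed.

(** This is where the strictness of d < a matters: the margin left by the
    simplices around x is the freedom to move x into D. *)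
Lemma rips_dense (a : R) (D : set X) :
  (forall x e, 0 < e -> exists2 y, D y & mdist x y < e) ->
  dense_vertices (rips X a) D.
Proof.
move=> Ddense x ss ssP.
pose vs := (\bigcup_(s <- ss) s)%fset.
have [|e e0 eP] := @uniform_slack X vs (mdist x) a.
  move=> v /bigfcupP[s]; rewrite andbT => /ssP[[_ sa] xs] vs'; exact: sa.
have [y Dy xy] := Ddense x e e0; exists y => // s sss.
have [[s0 sa] xs] := ssP s sss.
have yv v : v \in s -> mdist y v < a.
  move=> vs'; apply: le_lt_trans (metric_triangle y x v) _.
  apply: lt_le_trans (eP v _); last by apply/bigfcupP; exists s; rewrite ?sss.
  by rewrite addrC ltrD2l metric_sym.
split; first by apply/fset0Pn; exists y; rewrite fset1U1.
move=> u v; rewrite !inE => /predU1P[->|us] /predU1P[->|vs'].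
- by rewrite mdistxx -(mdistxx x) sa.
- exact: yv.
- by rewrite metric_sym; exact: yv.
- exact: sa.
Qed.
End Separable.

Theorem proposition5p10 (F : fieldType) (R : realType) (X : metricType R)
    (a : R) :
  totally_bounded X -> 0 < a ->
  has_countable_basis (total_homology F (rips X a)).
Proof.
move=> /totally_bounded_separable[D cD dD] _.
exact: total_homology_countable_basis cD (rips_dense dD).
Qed.
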